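(* Let $p$ be a prime, let $0\le a<b<n$ be integers, and let $L=AF(a,b,n,p)$ be the algebra of Albert and Frank, with its basis $\{e_\xi\mid\xi\in\mathbb{F}_{p^n}^{\ast}\}$. The outer derivation algebra $\operatorname{Der}(L)/\operatorname{ad}(L)$ has dimension $n$ (over $\mathbb{F}_{p^n}$). More precisely, every derivation of $L$ of degree zero with respect to the $\mathbb{F}_{p^n}$-grading of $L$ acts as $D_\pi e_\xi=c_\xi\cdot e_\xi$ for some additive map $\pi:\xi\mapsto c_\xi$ of $\mathbb{F}_{p^n}$ to itself; all derivations of nonzero degree are inner. Thus, a basis for the space of outer derivations is given by (the classes modulo $\operatorname{ad}(L)$ of) the derivations $(D_{\mathrm{id}})^{p^s}$, acting as $(D_{\mathrm{id}})^{p^s}e_\xi=\xi^{p^s}\cdot e_\xi$, for $0\le s<n$.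
   Context: The algebra of Albert and Frank $AF(a,b,n,p)$ is the Lie algebra over $\mathbb{F}_{p^n}$ with basis $\{e_\xi\mid\xi\in\mathbb{F}_{p^n}^{\ast}\}$ and multiplication $[e_\xi,e_\eta]=(\xi^{p^a}\eta^{p^b}-\xi^{p^b}\eta^{p^a})\,e_{\xi+\eta}$, where the right-hand side is interpreted as zero when $\xi+\eta=0$ (set $e_0=0$). It is graded over the additive group of $\mathbb{F}_{p^n}$ by giving $e_\xi$ degree $\xi$. Then $\operatorname{Der}(L)$, the Lie algebra of $\mathbb{F}_{p^n}$-linear derivations of $L$, is also graded over $\mathbb{F}_{p^n}$: a derivation $D$ has degree $\tau$ if $De_\xi\in\langle e_{\xi+\tau}\rangle$ for all $\xi\in\mathbb{F}_{p^n}^{\ast}$. $\operatorname{ad}(L)$ is the ideal of inner derivations, and $\mathrm{id}$ is the identity map of $\mathbb{F}_{p^n}$. *)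

(* Defs.v *)
From HB Require Import structures.
From mathcomp Require Import all_boot all_order all_algebra.
From mathcomp Require Import sesquilinear ring_quotient generic_quotient.
From mathcomp Require Import finfield ring.

Set Implicit Arguments.
Unset Strict Implicit.
Unset Printing Implicit Defensive.

Import GRing.Theory.
Local Open Scope ring_scope.

(* Quotients of finite-dimensional vector spaces. The library provides the    *)
(* Z-module {quot U} of cosets x + U; it is equipped here with the induced    *)
(* scaling, and with the dimension of a complement of U.                      *)

Definition vquot (K : fieldType) (vT : vectType K) (U : {vspace vT}) : Type :=
  Quotient.quot (U : zmodClosed vT).

Definition vpi (K : fieldType) (vT : vectType K) (U : {vspace vT}) (x : vT) :
  vquot U := (\pi_(Quotient.quot (U : zmodClosed vT)) x)%qT.

Section VectorQuotient.

Variables (K : fieldType) (vT : vectType K) (U : {vspace vT}).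

HB.instance Definition _ := GRing.Zmodule.on (vquot U).

Lemma vpi_eq (x y : vT) : (vpi U x == vpi U y) = (x - y \in U).
Proof. by rewrite Quotient.idealrBE. Qed.

Definition vrepr (q : vquot U) : vT :=
  @repr vT (Quotient.quot (U : zmodClosed vT)) q.

Lemma vreprK q : vpi U (vrepr q) = q.
Proof. exact: (@reprK vT (Quotient.quot (U : zmodClosed vT))). Qed.

Lemma vpiD x y : vpi U (x + y) = vpi U x + vpi U y.
Proof. exact: (Quotient.pi_add (U : zmodClosed vT)). Qed.

Definition vquot_scale (k : K) (q : vquot U) : vquot U := vpi U (k *: vrepr q).

Lemma vpiZ k x : vpi U (k *: x) = vquot_scale k (vpi U x).
Proof.
by apply/eqP; rewrite vpi_eq -scalerBr memvZ // -vpi_eq vreprK.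
Qed.

Fact vquot_scaleA k1 k2 q :
  vquot_scale k1 (vquot_scale k2 q) = vquot_scale (k1 * k2) q.
Proof. by rewrite -[q]vreprK -!vpiZ scalerA. Qed.

Fact vquot_scale1 : left_id 1 vquot_scale.
Proof. by move=> q; rewrite -[q]vreprK -vpiZ scale1r. Qed.

Fact vquot_scaleDr : right_distributive vquot_scale +%R.
Proof.
by move=> k q r; rewrite -[q]vreprK -[r]vreprK -vpiD -!vpiZ -vpiD scalerDr.
Qed.

Fact vquot_scaleDl q : {morph vquot_scale^~ q : k l / k + l}.
Proof. by move=> k l /=; rewrite -[q]vreprK -!vpiZ -vpiD scalerDl. Qed.

HB.instance Definition _ := GRing.Zmodule_isLmodule.Build K (vquot U)
  vquot_scaleA vquot_scale1 vquot_scaleDr vquot_scaleDl.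

Fact vpi_is_linear : linear (vpi U).
Proof. by move=> k x y; rewrite vpiD vpiZ. Qed.

HB.instance Definition _ :=
  GRing.isLinear.Build K vT (vquot U) _ (vpi U) vpi_is_linear.

Import VectorInternalTheory.

Let W := (U^C)%VS.
Let sW : vectType K := subvs_of W.

Let coset_rep (x : vT) : sW := vsproj W (daddv_pi W U x).

Let dWU : (W :&: U = 0)%VS. Proof. by rewrite capvC capv_compl. Qed.

Let rep_spec x : x - vsval (coset_rep x) \in U.
Proof.
rewrite /coset_rep vsprojK ?memv_pi //.
have xWU : x \in (W + U)%VS by rewrite addvC addv_complf memvf.
by rewrite -{1}(daddv_pi_add dWU xWU) addrC addKr memv_pi.
Qed.

Let rep_uniq x y : vpi U x = vpi U y -> coset_rep x = coset_rep y.
Proof.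
move=> /eqP; rewrite vpi_eq => xyU.
apply/val_inj/eqP; rewrite -subr_eq0 -memv0 -dWU memv_cap memvB ?subvsP //=.
rewrite -[X in X \in U](subrK (x - y)) memvD //.
have -> : vsval (coset_rep x) - vsval (coset_rep y) - (x - y) =
  (y - vsval (coset_rep y)) - (x - vsval (coset_rep x)).
  by rewrite !opprB addrACA [RHS]addrACA (addrC y).
by rewrite memvB ?rep_spec.
Qed.

Fact vquot_vect_iso : Vector.axiom (dim sW) (vquot U).
Proof.
pose v2rW : sW -> 'rV_(dim sW) := v2r.
pose r2vW : 'rV_(dim sW) -> sW := r2v.
have v2rWK : cancel v2rW r2vW := @v2rK K sW.
have r2vWK : cancel r2vW v2rW := @r2vK K sW.
exists (fun q => v2rW (coset_rep (vrepr q))).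
  move=> k q r.
  have -> : k *: q + r = vpi U (k *: vrepr q + vrepr r).
    by rewrite vpi_is_linear !vreprK.
  rewrite (rep_uniq (vreprK _)) /coset_rep.
  rewrite (linearP (daddv_pi W U)) (linearP (vsproj W)).
  exact: linearP.
exists (fun r => vpi U (vsval (r2vW r))) => [q|r].
  rewrite v2rWK -[RHS]vreprK; apply/eqP.
  by rewrite vpi_eq -memvN opprB rep_spec.
rewrite (rep_uniq (vreprK _)) -[RHS]r2vWK; congr v2rW.
apply/val_inj/eqP; rewrite -subr_eq0 -memv0 -dWU memv_cap.
by rewrite memvB ?subvsP //= -memvN opprB rep_spec.
Qed.

HB.instance Definition _ := Lmodule_hasFinDim.Build K (vquot U) vquot_vect_iso.

End VectorQuotient.

Section Derivations.

Variables (K : fieldType) (V : vectType K) (br : {bilinear V -> V -> V}).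

Definition is_derivation (D : 'End(V)) : Prop :=
  forall x y : V, D (br x y) = br (D x) y + br x (D y).

Definition leibniz_defect (D : 'End(V)) (x y : V) : V :=
  D (br x y) - (br (D x) y + br x (D y)).

Fact leibniz_defect_linear_r D x : linear (leibniz_defect D x).
Proof.
move=> k y z; rewrite /leibniz_defect !(linearPr br) !(linearP D) !(linearPr br).
by rewrite addrACA -scalerDr opprD addrACA scalerBr.
Qed.

HB.instance Definition _ D x := GRing.isLinear.Build K V V _
  (leibniz_defect D x) (leibniz_defect_linear_r D x).

Definition leibniz_defect1 (D : 'End(V)) (x : V) : 'End(V) :=
  linfun (leibniz_defect D x).

Fact leibniz_defect1_linear D : linear (leibniz_defect1 D).
Proof.
move=> k x z; apply/lfunP=> y; rewrite add_lfunE scale_lfunE !lfunE /=.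
rewrite /leibniz_defect !(linearPl br) !(linearP D) !(linearPl br).
by rewrite addrACA -scalerDr opprD addrACA scalerBr.
Qed.

HB.instance Definition _ D := GRing.isLinear.Build K V 'End(V) _
  (leibniz_defect1 D) (leibniz_defect1_linear D).

Definition leibniz_defect2 (D : 'End(V)) : 'Hom(V, 'End(V)) :=
  linfun (leibniz_defect1 D).

Fact leibniz_defect2_linear : linear leibniz_defect2.
Proof.
move=> k D E; apply/lfunP=> x; apply/lfunP=> y.
rewrite !add_lfunE !scale_lfunE !lfunE /=.
rewrite /leibniz_defect !add_lfunE !scale_lfunE (linearPl br) (linearPr br).
by rewrite addrACA -scalerDr opprD addrACA scalerBr.
Qed.

HB.instance Definition _ := GRing.isLinear.Build K 'End(V) 'Hom(V, 'End(V)) _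
  leibniz_defect2 leibniz_defect2_linear.

(* Der(V) as a subspace of 'End(V); see derP. *)
Definition der : {vspace 'End(V)} := lker (linfun leibniz_defect2).

Lemma derP (D : 'End(V)) : reflect (is_derivation D) (D \in der).
Proof.
rewrite memv_ker lfunE; apply: (iffP eqP) => [D0 x y | derD].
  apply/eqP; rewrite -subr_eq0; apply/eqP.
  have := congr1 (fun f : 'Hom(V, 'End(V)) => f x y) D0.
  by rewrite !lfunE.
apply/lfunP=> x; apply/lfunP=> y; rewrite !lfunE /= /leibniz_defect derD.
by rewrite subrr.
Qed.

Definition ad (x : V) : 'End(V) := linfun (br x).

Fact ad_is_linear : linear ad.
Proof.
move=> k x y; apply/lfunP=> z.
by rewrite add_lfunE scale_lfunE !lfunE /= (linearPl br).
Qed.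

HB.instance Definition _ := GRing.isLinear.Build K V 'End(V) _ ad ad_is_linear.

Definition inner_der : {vspace 'End(V)} := limg (linfun ad).

Lemma inner_derP (D : 'End(V)) :
  reflect (exists x : V, D = ad x) (D \in inner_der).
Proof.
apply: (iffP memv_imgP) => [[x _ ->] | [x ->]]; exists x; rewrite ?memvf //.
  by rewrite lfunE.
by rewrite lfunE.
Qed.

(* Der(V) / ad(V), as the subspace of 'End(V) / ad(V) consisting of the       *)
(* cosets of derivations; ad(V) is contained in Der(V) when br is a Lie       *)
(* bracket (inner_der_sub below).                                             *)
Definition out_class (D : 'End(V)) : vquot inner_der := vpi inner_der D.

Definition outder : {vspace vquot inner_der} :=
  (linfun (vpi inner_der) @: der)%VS.

End Derivations.

(* The k-fold composite; the ring structure of 'End(V) is not canonical.      *)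
Definition lfun_exp (K : fieldType) (V : vectType K) (f : 'End(V)) (k : nat) :
  'End(V) := iter k (comp_lfun f) \1%VF.

(* The space of the algebra of Albert and Frank: vectors are given by their   *)
(* coordinates on the basis e_xi, xi in {unit F}. The product is AFbr F a b p *)
(* below; the exponent n of AF(a,b,n,p) is determined by #|F| = p ^ n.        *)

Definition AF (F : finFieldType) : vectType F := {ffun {unit F} -> F^o}.

Section AlbertFrank.

Variables (F : finFieldType) (a b p : nat).

(* e_xi for nonzero xi; this also yields e_0 = 0. *)
Definition AFe (xi : F) : AF F := [ffun u : {unit F} => (val u == xi)%:R].

Definition AFcoef (xi eta : F) : F :=
  xi ^+ (p ^ a) * eta ^+ (p ^ b) - xi ^+ (p ^ b) * eta ^+ (p ^ a).

Definition AFbr (x y : AF F) : AF F :=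
  \sum_(u : {unit F}) \sum_(v : {unit F})
    (x u * y v * AFcoef (val u) (val v)) *: AFe (val u + val v).

Fact AFbr_linear_l y : linear (AFbr^~ y).
Proof.
move=> k x z; rewrite /AFbr scaler_sumr -big_split; apply: eq_bigr => u _ /=.
rewrite scaler_sumr -big_split; apply: eq_bigr => v _ /=.
have -> : (k *: x + z) u = k * x u + z u by rewrite !ffunE.
by rewrite !mulrDl scalerDl scalerA -!mulrA.
Qed.

Fact AFbr_linear_r x : linear (AFbr x).
Proof.
move=> k y z; rewrite /AFbr scaler_sumr -big_split; apply: eq_bigr => u _ /=.
rewrite scaler_sumr -big_split; apply: eq_bigr => v _ /=.
have -> : (k *: y + z) v = k * y v + z v by rewrite !ffunE.
have E (r s t c : F) : r * (k * s + t) * c = k * (r * s * c) + r * t * c.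
  by rewrite mulrDr mulrDl mulrCA -!mulrA.
by rewrite (E (x u) (y v)) scalerDl scalerA.
Qed.

HB.instance Definition _ := bilinear_isBilinear.Build F (AF F) (AF F) (AF F) _ _
  AFbr (AFbr_linear_l, AFbr_linear_r).

Lemma AFe0 : AFe 0 = 0.
Proof.
apply/ffunP=> u; rewrite !ffunE.
by have /negPf-> : val u != 0 by rewrite -unitfE; apply: valP.
Qed.

Lemma AF_sum_e (x : AF F) : x = \sum_(u : {unit F}) x u *: AFe (val u).
Proof.
apply/ffunP=> v; rewrite sum_ffunE (bigD1 v) //= !ffunE eqxx [_ *: _]mulr1.
rewrite big1 ?addr0 // => u /negPf neq_uv.
by rewrite !ffunE val_eqE eq_sym neq_uv [_ *: _]mulr0.
Qed.

Lemma AFbr_e (xi eta : F) : xi != 0 -> eta != 0 ->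
  AFbr (AFe xi) (AFe eta) = AFcoef xi eta *: AFe (xi + eta).
Proof.
rewrite -!unitfE => Uxi Ueta; rewrite /AFbr.
rewrite (bigD1 (FinRing.Unit Uxi)) //= [X in _ + X]big1 ?addr0; last first.
  move=> u neq_u; apply: big1 => v _; rewrite ffunE.
  by rewrite (negPf (_ : val u != xi)) ?mul0r ?scale0r.
rewrite (bigD1 (FinRing.Unit Ueta)) //= [X in _ + X]big1 ?addr0; last first.
  move=> v neq_v; rewrite [AFe eta v]ffunE.
  by rewrite (negPf (_ : val v != eta)) ?mulr0 ?mul0r ?scale0r.
by rewrite !ffunE !eqxx !mul1r.
Qed.

(* For xi = - tau the condition reads D e_xi = 0, as e_0 = 0. *)
Definition AFdegree (tau : F) (D : 'End(AF F)) : Prop :=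
  forall xi : F, xi != 0 -> D (AFe xi) \in <[AFe (xi + tau)%R]>%VS.

(* D_pi : e_xi |-> pi xi *: e_xi, see AFD_e. *)
Definition AFD (pi : F -> F) : 'End(AF F) :=
  linfun (fun x : AF F => [ffun u : {unit F} => pi (val u) * x u] : AF F).

Lemma AFD_e (pi : F -> F) (xi : F) : AFD pi (AFe xi) = pi xi *: AFe xi.
Proof.
pose f (x : AF F) : AF F := [ffun u : {unit F} => pi (val u) * x u].
have f_lin : linear f.
  by move=> k x y; apply/ffunP=> u; rewrite !ffunE mulrDr mulrCA.
pose f' : {linear AF F -> AF F} :=
  HB.pack f (GRing.isLinear.Build F (AF F) (AF F) _ f f_lin).
rewrite /AFD (lfunE f'); apply/ffunP=> u; rewrite !ffunE.
by case: eqP => [->|_] //; rewrite mulr0 [RHS]mulr0.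
Qed.

End AlbertFrank.

Arguments AFbr F a b p x y : clear implicits.

Section Lie.

Variables (F : finFieldType) (a b p n : nat).
Hypotheses (p_pr : prime p) (cardF : #|F| = (p ^ n)%N).

Local Notation br := (AFbr F a b p).

Let frobD k (xi eta : F) :
  (xi + eta) ^+ (p ^ k) = xi ^+ (p ^ k) + eta ^+ (p ^ k).
Proof.
have charF : p \in [pchar F] by apply: (card_finPcharP cardF).
by rewrite exprDn_pchar // pnatX pnatE // charF.
Qed.

Let br_e (xi eta : F) :
  br (AFe xi) (AFe eta) = AFcoef a b p xi eta *: AFe (xi + eta).
Proof.
have p0 k : (0 : F) ^+ (p ^ k) = 0.
  by rewrite expr0n expn_eq0 -leqn0 leqNgt prime_gt0.
have [->|xi0] := eqVneq xi 0.
  by rewrite AFe0 (linear0l (br : {bilinear _ -> _ -> _})) /AFcoef !p0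
     !mul0r subrr scale0r.
have [->|eta0] := eqVneq eta 0; last exact: AFbr_e.
by rewrite AFe0 (linear0r (br : {bilinear _ -> _ -> _})) /AFcoef !p0
     !mulr0 subrr scale0r.
Qed.

Lemma AF_jacobi x y z : br x (br y z) = br (br x y) z + br y (br x z).
Proof.
have [B Be <-] : exists2 B : {bilinear AF F -> AF F -> AF F},
    forall xi eta, B (AFe xi) (AFe eta) = AFcoef a b p xi eta *: AFe (xi + eta)
    & B = br :> (_ -> _ -> _) by exists br.
have BZl k u v : B (k *: u) v = k *: B u v by exact: linearZl_LR.
have BZr k u v : B u (k *: v) = k *: B u v by exact: linearZr_LR.
rewrite (AF_sum_e x) !(linear_sumlz B) !(linear_sumr B) -big_split.
apply: eq_bigr => u _; rewrite /= !(BZl, BZr) -scalerDr; congr (_ *: _).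
rewrite (AF_sum_e y) !(linear_sumlz B) !(linear_sumr B) !(linear_sumlz B).
rewrite -big_split; apply: eq_bigr => v _.
rewrite /= !(BZl, BZr) -scalerDr; congr (_ *: _).
rewrite (AF_sum_e z) !(linear_sumr B) -big_split; apply: eq_bigr => w _.
rewrite /= !(BZl, BZr) -scalerDr; congr (_ *: _).
rewrite !(Be, BZl, BZr) !scalerA addrA [val v + (_ + _)]addrCA addrA -scalerDl.
by congr (_ *: _); rewrite /AFcoef !frobD; ring.
Qed.

Lemma inner_der_sub : (inner_der br <= der br)%VS.
Proof.
apply/subvP=> _ /inner_derP[x ->]; apply/derP=> y z.
by rewrite !lfunE; apply: AF_jacobi.
Qed.

End Lie.

(* Main.v *)
(** Write [f] for [AFcoef]. The coefficients [c x] of a derivation of degree [t],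
    in [D e_x = c x e_(x+t)], satisfy
      [f x y (c (x + y) - c x - c y) = f t y * c x - f t x * c y],
    and [f x y] vanishes only when [x] and [y] are proportional over a proper
    subfield of [F]. For [t = 0] this makes [c] additive, proportional pairs being
    handled with a third, independent element. For [t <> 0] the equation forces
    [c (x + t) = c x], and subtracting it at [(x, y)] from itself at [(x + t, y)]
    gives [c (x + y) = c x + c y] when [f t y <> 0], hence [f t y * c x = f t x * c y],
    so that [c] is a multiple of [f t], the coefficients of [ad e_t]. Finally, the
    additive maps of [F] have the powers [x ^+ (p ^ s)], [s < n], as a basis, and no
    nonzero inner derivation has degree [0] because [e_0 = 0]. *)

From HB Require Import structures.
Require Import Defs.
From mathcomp Require Import all_boot all_order all_algebra.
From mathcomp Require Import sesquilinear finfield ring.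

Set Implicit Arguments.
Unset Strict Implicit.
Unset Printing Implicit Defensive.

Import GRing.Theory.
Local Open Scope ring_scope.

(** * Frobenius powers and additive maps of [F] *)

Section FrobeniusPowers.

Variables (F : finFieldType) (p n : nat).
Hypotheses (p_pr : prime p) (cardF : #|F| = (p ^ n)%N).

Lemma frob_pnat k : [pchar F].-nat (p ^ k)%N.
Proof. by rewrite pnatX pnatE // (card_finPcharP cardF p_pr). Qed.

Lemma frobD k (x y : F) : (x + y) ^+ (p ^ k) = x ^+ (p ^ k) + y ^+ (p ^ k).
Proof. exact/exprDn_pchar/frob_pnat. Qed.

Lemma frobN k (x : F) : (- x) ^+ (p ^ k) = - x ^+ (p ^ k).
Proof. exact/exprNn_pchar/frob_pnat. Qed.

Lemma frob0 k : (0 : F) ^+ (p ^ k) = 0.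
Proof. by rewrite expr0n expn_eq0 -leqn0 leqNgt prime_gt0. Qed.

(** The associated polynomial has degree at most [p ^ (n - 1)], less than [#|F|], so it cannot
    vanish on all of [F] unless it is zero. *)
Lemma frob_free (c : 'I_n -> F) :
  (forall x, \sum_(s < n) c s * x ^+ (p ^ s) = 0) -> forall s, c s = 0.
Proof.
move=> c0 s; pose P : {poly F} := \sum_(s < n) c s *: 'X^(p ^ s).
have exp_inj (i j : 'I_n) : ((p ^ i)%N == (p ^ j)%N) = (i == j).
  by rewrite eqn_exp2l ?prime_gt1.
have coefP : P`_(p ^ s) = c s.
  rewrite coef_sum (bigD1 s) //= coefZ coefXn eqxx mulr1 big1 ?addr0 // => i neq.
  by rewrite coefZ coefXn exp_inj eq_sym (negPf neq) mulr0.
suff P0 : P = 0 by rewrite -coefP P0 coef0.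
apply/eqP; apply: contraT => nzP.
have sizeP : (size P <= #|F|)%N.
  apply: leq_trans (size_sum _ _ _) _; apply/bigmax_leqP => i _.
  apply: leq_trans (size_scale_leq _ _) _.
  by rewrite size_polyXn cardF ltn_exp2l ?prime_gt1.
have rootsP : all (root P) (enum F).
  apply/allP=> x _; rewrite /root horner_sum -[X in _ == X](c0 x); apply/eqP.
  by apply: eq_bigr => i _; rewrite hornerZ hornerXn.
have := max_poly_roots nzP rootsP (enum_uniq F).
by rewrite -cardE ltnNge sizeP.
Qed.

(** By counting, [F] has dimension [n] over its prime field. Coordinates there lift to natural
    numbers, with which every additive map commutes. *)
Lemma additive_generators :
  exists e : 'I_n -> F,
    forall x, exists k : 'I_n -> nat, x = \sum_(i < n) e i *+ k i.
Proof.
have charF := card_finPcharP cardF p_pr.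
pose R := pPrimeCharType charF.
have dimR : \dim {:R} = n.
  have : #|{:R}%VS| = (p ^ n)%N by rewrite card_vspacef.
  by rewrite card_vspace card_Fp // => /eqP; rewrite eqn_exp2l ?prime_gt1 // => /eqP.
exists (fun i => (vbasis {:R})`_i) => x.
have def_x := coord_vbasis (memvf (x : R)).
exists (fun i => coord (vbasis {:R}) (cast_ord (esym dimR) i) (x : R) : nat).
rewrite [LHS]def_x (reindex (cast_ord (esym dimR))); last first.
  by exists (cast_ord dimR) => i _; rewrite (cast_ordK, cast_ordKV).
by apply: eq_bigr => i _; rewrite -mulr_natl.
Qed.

Lemma additive_frobE (c : F -> F) : {morph c : x y / x + y} ->
  exists k : 'I_n -> F, forall x, c x = \sum_(s < n) k s * x ^+ (p ^ s).
Proof.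
move=> cD; have [e gen_e] := additive_generators.
have addMn (f : F -> F) : {morph f : x y / x + y} ->
    forall k : 'I_n -> nat,
      f (\sum_i e i *+ k i) = \sum_i f (e i) *+ k i.
  move=> fD k; have f0 : f 0 = 0 by apply: (addrI (f 0)); rewrite -fD !addr0.
  rewrite (big_morph f fD f0); apply: eq_bigr => i _.
  by elim: (k i) => [|m IHm]; rewrite ?mulr0n // !mulrS fD IHm.
pose lin (k : 'I_n -> F) x := \sum_(s < n) k s * x ^+ (p ^ s).
have linD k : {morph lin k : x y / x + y}.
  move=> x y; rewrite /lin -big_split; apply: eq_bigr => s _ /=.
  by rewrite frobD mulrDr.
have ext (f g : F -> F) : {morph f : x y / x + y} -> {morph g : x y / x + y} ->
    (forall i, f (e i) = g (e i)) -> f =1 g.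
  move=> fD gD fg x; have [k ->] := gen_e x; rewrite !addMn //.
  by apply: eq_bigr => i _; rewrite fg.
(* The Moore matrix of the generators. *)
pose M := \matrix_(s < n, i < n) e i ^+ (p ^ s).
have linM (v : 'rV_n) i : (v *m M) 0 i = lin (v 0) (e i).
  by rewrite mxE; apply: eq_bigr => s _; rewrite mxE.
(* A row in the left kernel gives a combination of Frobenius powers that vanishes on the generators,
   hence on [F]. *)
have unitM : M \in unitmx.
  rewrite -row_free_unit -kermx_eq0; apply/rowV0P => v /sub_kermxP vM0.
  apply/rowP=> s; rewrite mxE; apply: frob_free s.
  apply: (ext (lin (v 0)) (fun=> 0)) => // [x y|i]; first by rewrite addr0.
  by rewrite -linM vM0 mxE.
(* Interpolation of [c] at the generators. *)
exists (((\row_i c (e i)) *m invmx M) 0).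
apply: (ext c (lin _)) => // i.
by rewrite -linM mulmxKV // mxE.
Qed.

(** * Structure constants and the equation for derivation coefficients *)

Variables a b : nat.
Hypotheses (lt_ab : (a < b)%N) (lt_bn : (b < n)%N).
Local Notation f := (AFcoef a b p).

Lemma AFcoefC (x y : F) : f y x = - f x y.
Proof. by rewrite /AFcoef; ring. Qed.

Lemma AFcoefDl (x y z : F) : f (x + y) z = f x z + f y z.
Proof. by rewrite /AFcoef !frobD; ring. Qed.

Lemma AFcoefDr (x y z : F) : f x (y + z) = f x y + f x z.
Proof. by rewrite /AFcoef !frobD; ring. Qed.

Lemma AFcoefNl (x y : F) : f (- x) y = - f x y.
Proof. by rewrite /AFcoef !frobN; ring. Qed.

Lemma AFcoefNr (x y : F) : f x (- y) = - f x y.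
Proof. by rewrite AFcoefC AFcoefNl AFcoefC opprK. Qed.

Lemma AFcoef0l (x : F) : f 0 x = 0.
Proof. by rewrite /AFcoef !frob0 !mul0r subrr. Qed.

Lemma AFcoef0r (x : F) : f x 0 = 0.
Proof. by rewrite AFcoefC AFcoef0l oppr0. Qed.

Lemma AFcoefxx (x : F) : f x x = 0.
Proof. by rewrite /AFcoef mulrC subrr. Qed.

(* [s] belongs to the proper subfield fixed by the Frobenius power [b - a],
   over which AFcoef is semilinear. *)
Lemma AFcoef_eq0 (x y : F) : x != 0 -> f x y = 0 ->
  exists s, y = s * x /\ forall z w, f (s * z) w = s ^+ (p ^ a) * f z w.
Proof.
move=> nzx fxy0; exists (y / x); split; first by rewrite mulfVK.
move=> z w; suff E : (y / x) ^+ (p ^ b) = (y / x) ^+ (p ^ a).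
  by rewrite /AFcoef; move: (y / x) E => s E; rewrite !exprMn E; ring.
have nzX k : x ^+ (p ^ k) != 0 by rewrite expf_neq0.
apply/eqP; rewrite !expr_div_n eqr_div // [_ * x ^+ _]mulrC.
by rewrite -subr_eq0 [X in _ - X]mulrC -[X in X == _]/(f x y) fxy0.
Qed.

(** As a function of [y], [f x y] is a combination of two distinct Frobenius powers with nonzero
    coefficients, so [frob_free] applies. *)
Lemma AFcoef_neq0 (x : F) : x != 0 -> exists y, f x y != 0.
Proof.
move=> nzx; apply/existsP; apply: contraT => /existsPn f0.
pose ia : 'I_n := Ordinal (ltn_trans lt_ab lt_bn); pose ib : 'I_n := Ordinal lt_bn.
have neq_ba : (ib == ia) = false by rewrite -val_eqE /= gtn_eqF.
pose c (s : 'I_n) : F := (s == ib)%:R * x ^+ (p ^ a) - (s == ia)%:R * x ^+ (p ^ b).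
suff /(_ ib) : forall s, c s = 0.
  rewrite /c eqxx neq_ba mul1r mul0r subr0 => /eqP.
  by rewrite expf_eq0 (negPf nzx) andbF.
apply: frob_free => y; rewrite -[RHS](eqP (negPn (f0 y))) /AFcoef.
rewrite (bigD1 ib) //= (bigD1 ia) 1?eq_sym ?neq_ba //= big1.
  rewrite /c !eqxx neq_ba eq_sym neq_ba /=.
  by rewrite !mul1r !mul0r subr0 sub0r mulNr addr0.
by move=> s /andP[/negPf nb /negPf na]; rewrite /c nb na !mul0r subrr mul0r.
Qed.

(* Where [D e_x = c x e_(x+t)]. *)
Definition derivation_coef (t : F) (c : F -> F) :=
  forall x y, f x y * c (x + y) = f (x + t) y * c x + f x (y + t) * c y.

Lemma derivation_coefE t c : derivation_coef t c -> forall x y,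
  f x y * (c (x + y) - c x - c y) = f t y * c x - f t x * c y.
Proof.
move=> derc x y; rewrite !mulrBr derc AFcoefDl AFcoefDr (AFcoefC t x); ring.
Qed.

Lemma derivation_coef0_additive c : c 0 = 0 -> derivation_coef 0 c ->
  {morph c : x y / x + y}.
Proof.
move=> c0 /derivation_coefE derc.
have addc x y : f x y != 0 -> c (x + y) = c x + c y.
  move=> nzf; apply/eqP; rewrite -subr_eq0 opprD addrA -(mulrI_eq0 _ (mulfI nzf)).
  by rewrite derc !AFcoef0l !mul0r subrr.
move=> x y; have [fxy0|/addc//] := eqVneq (f x y) 0.
have [->|nzx] := eqVneq x 0; first by rewrite c0 !add0r.
have [->|nzy] := eqVneq y 0; first by rewrite c0 !addr0.
(* A third element outside the line of [x] and [y]. *)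
have [s [def_y fs]] := AFcoef_eq0 nzx fxy0; have [z nzf] := AFcoef_neq0 nzx.
have sN0 u : u * x != 0 -> u ^+ (p ^ a) != 0.
  by rewrite mulf_eq0 negb_or => /andP[nzu _]; rewrite expf_neq0.
have fyz : f y z != 0 by rewrite def_y fs mulf_neq0 // sN0 -?def_y.
have cxyz : c (x + y + z) = c (x + y) + c z.
  have [->|nzxy] := eqVneq (x + y) 0; first by rewrite c0 !add0r.
  have def_xy : x + y = (1 + s) * x by rewrite mulrDl mul1r -def_y.
  apply: addc; rewrite AFcoefDl def_y fs.
  have -> : f x z + s ^+ (p ^ a) * f x z = (1 + s) ^+ (p ^ a) * f x z.
    by rewrite frobD expr1n mulrDl mul1r.
  by rewrite mulf_neq0 // sN0 -?def_xy.
(* Bracketing [x + (y + z)] instead uses only the independent pairs [(x, y + z)] and [(y, z)]. *)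
apply: (addIr (c z)); rewrite -cxyz -addrA addc ?addc //; first by rewrite addrA.
by rewrite AFcoefDr fxy0 add0r.
Qed.

(** The value at [- t] is the coefficient on [e_0 = 0], read as zero; it anchors the invariance of
    [c] under translation by [t]. *)
Lemma derivation_coef_inner t c : t != 0 -> c (- t) = 0 ->
  derivation_coef t c -> exists l, forall x, c x = l * f t x.
Proof.
move=> nzt cNt derc; have dercE := derivation_coefE derc.
have [z nzz] := AFcoef_neq0 nzt.
have c0 : c 0 = 0.
  have := dercE 0 z; rewrite !AFcoef0l AFcoef0r !mul0r subr0 => /esym/eqP.
  by rewrite mulf_eq0 (negPf nzz) => /eqP.
have ct_out x : f t x != 0 -> c (x + t) = c x.
  have -> : f t x = f t (x + t) by rewrite AFcoefDr AFcoefxx addr0.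
  move=> nzx; apply/eqP.
  (* With [y = - t] the right-hand side vanishes, since [f t t = 0] and [c (- t) = 0]. *)
  have := dercE (x + t) (- t).
  rewrite addrK cNt subr0 mulr0 !AFcoefNr AFcoefxx oppr0 mul0r addr0.
  rewrite (AFcoefC t) opprK => /eqP.
  by rewrite mulf_eq0 (negPf nzx) subr_eq0 eq_sym.
(* On the line of [t], [x = s * t]. The cases [s = 0] and [s = -1] are known values of [c];
   otherwise the equation at [(s * z, x)] leaves [c x] times a power of [1 + s] and nonzero
   factors. *)
have c_line x : f t x = 0 -> c x = 0.
  move=> ftx0; have [s [def_x fs]] := AFcoef_eq0 nzt ftx0.
  have [s0|nzs] := eqVneq s 0; first by rewrite def_x s0 mul0r.
  have [sN1|nzs1] := eqVneq (1 + s) 0.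
    by rewrite def_x -[s](addKr 1) sN1 addr0 mulN1r.
  have nzsa : s ^+ (p ^ a) != 0 by rewrite expf_neq0.
  have fsr u v : f u (s * v) = s ^+ (p ^ a) * f u v.
    by rewrite AFcoefC fs (AFcoefC u v) mulrN opprK.
  have c_s y : f t y != 0 -> c (s * y) = s ^+ (p ^ a) * c y.
    (* Proportional arguments kill the left-hand side, which makes [c] semilinear in [s] off the
       line of [t]. *)
    move=> nzy; have := dercE y (s * y).
    rewrite !fsr AFcoefxx mulr0 mul0r => /esym/eqP; rewrite subr_eq0 => /eqP E.
    by apply: (mulfI nzy); rewrite -E; ring.
  have nzzt : f t (z + t) != 0 by rewrite AFcoefDr AFcoefxx addr0.
  have E : c (s * z + x) = c (s * z).
    by rewrite def_x -mulrDr c_s // ct_out // c_s.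
  have := dercE (s * z) x; rewrite E subrr sub0r ftx0 mul0r sub0r.
  rewrite def_x fs !fsr (AFcoefC t z) -def_x => /eqP.
  rewrite -subr_eq0.
  have -> : s ^+ (p ^ a) * (s ^+ (p ^ a) * - f t z) * - c x -
      - (s ^+ (p ^ a) * f t z * c x) =
      s ^+ (p ^ a) * f t z * (1 + s) ^+ (p ^ a) * c x.
    by rewrite frobD expr1n; ring.
  by rewrite !mulf_eq0 (negPf nzsa) (negPf nzz) expf_eq0 (negPf nzs1) andbF => /eqP.
have ct x : c (x + t) = c x.
  have [ftx0|/ct_out//] := eqVneq (f t x) 0.
  by rewrite !c_line // AFcoefDr ftx0 AFcoefxx addr0.
exists (c z / f t z) => x.
have cD : c (x + z) = c x + c z.
  (* Subtract the equation at [x, z] from the equation at [x + t, z]. *)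
  have E1 := dercE x z; have := dercE (x + t) z.
  rewrite (addrAC x t) !ct AFcoefDl AFcoefDr AFcoefxx addr0 mulrDl E1.
  move/(canRL (addKr _)); rewrite addNr => /eqP.
  by rewrite mulf_eq0 (negPf nzz) /= subr_eq0 subr_eq [c z + _]addrC => /eqP.
(* Additivity at [(x, z)] leaves [f t z * c x = f t x * c z]. *)
have := dercE x z; rewrite cD [c x + _ - c x]addrAC subrr add0r subrr mulr0.
move/esym/eqP; rewrite subr_eq0 => /eqP E.
by apply: (mulfI nzz); rewrite E mulrA [_ * (_ / _)]mulrC mulfVK // mulrC.
Qed.

End FrobeniusPowers.

(** * Coordinates on the basis [e_xi] *)

Section Coordinates.

Variable F : finFieldType.

(* The coefficient of [x] on [e_y], which is [0] for [y = 0]. *)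
Definition AFcoord (y : F) (x : AF F) : F := \sum_(u : {unit F} | val u == y) x u.

Fact AFcoord_linear y : linear (AFcoord y : AF F -> F^o).
Proof.
move=> k x z; rewrite /AFcoord scaler_sumr -big_split /=.
by apply: eq_bigr => u _; rewrite !ffunE.
Qed.

HB.instance Definition _ y := GRing.isLinear.Build F (AF F) F^o _
  (AFcoord y : AF F -> F^o) (AFcoord_linear y).

Lemma AFcoord0 x : AFcoord 0 x = 0.
Proof.
rewrite /AFcoord big_pred0 // => u.
by apply/negbTE; rewrite -unitfE; apply: valP.
Qed.

Lemma AFcoord_e (x y : F) : x != 0 -> AFcoord y (AFe x) = (x == y)%:R.
Proof.
rewrite -unitfE => Ux; rewrite /AFcoord.
under eq_bigr do rewrite ffunE.
have [<-|neq] := eqVneq x y.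
  by rewrite (big_pred1 (FinRing.Unit Ux)) /= ?eqxx.
by rewrite big1 // => u /eqP ->; rewrite eq_sym (negPf neq).
Qed.

Lemma AF_sum_coord (x : AF F) : x = \sum_(y : F) AFcoord y x *: AFe y.
Proof.
rewrite [LHS]AF_sum_e (partition_big (fun u : {unit F} => val u) xpredT) //=.
apply: eq_bigr => y _; rewrite /AFcoord scaler_suml.
by apply: eq_bigr => u /eqP ->.
Qed.

Lemma AF_lfunP (V : vectType F) (D E : 'Hom(AF F, V)) :
  (forall x, x != 0 -> D (AFe x) = E (AFe x)) -> D = E.
Proof.
move=> DE; apply/lfunP => x; rewrite (AF_sum_coord x) !linear_sum.
apply: eq_bigr => y _; rewrite !linearZ /=; congr (_ *: _).
by have [->|/DE] := eqVneq y 0; first by rewrite AFe0 !linear0.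
Qed.

End Coordinates.

(** * Homogeneous components of derivations *)

Section AlbertFrankDerivations.

Variables (F : finFieldType) (p n a b : nat).
Hypotheses (p_pr : prime p) (cardF : #|F| = (p ^ n)%N).

Local Notation br := (AFbr F a b p).
Local Notation f := (AFcoef a b p).

Lemma AFbr_eE (x y : F) : br (AFe x) (AFe y) = f x y *: AFe (x + y).
Proof.
have [->|nzx] := eqVneq x 0.
  rewrite AFe0 (linear0l (br : {bilinear _ -> _ -> _})).
  by rewrite (AFcoef0l p_pr) scale0r.
have [->|nzy] := eqVneq y 0; last exact: AFbr_e.
rewrite AFe0 (linear0r (br : {bilinear _ -> _ -> _})).
by rewrite (AFcoef0r p_pr) scale0r.
Qed.

Lemma AFbr_er x (z : F) :
  br x (AFe z) = \sum_(y : F) (AFcoord y x * f y z) *: AFe (y + z).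
Proof.
rewrite [in LHS](AF_sum_coord x) (linear_sumlz (br : {bilinear _ -> _ -> _})).
apply: eq_bigr => y _.
by rewrite (linearZl_LR (br : {bilinear _ -> _ -> _})) /= AFbr_eE scalerA.
Qed.

Lemma AFbrC x y : br y x = - br x y.
Proof.
rewrite /AFbr exchange_big -sumrN; apply: eq_bigr => u _ /=.
rewrite -sumrN; apply: eq_bigr => v _.
by rewrite AFcoefC [val v + _]addrC [y v * _]mulrC mulrN scaleNr.
Qed.

(** Only the [e_y] term of [x] reaches degree [y + z]. If [y + z = 0], the term lost with [e_0] had
    coefficient [f (- z) z = 0], so no exception arises. *)
Lemma AFcoord_br_er x (y z : F) :
  AFcoord (y + z) (br x (AFe z)) = f y z * AFcoord y x.
Proof.
have fNz : f (- z) z = 0 by rewrite (AFcoefNl p_pr cardF) AFcoefxx oppr0.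
have [yz0|nzyz] := eqVneq (y + z) 0.
  by rewrite yz0 AFcoord0 -[y](addrK z) yz0 sub0r fNz mul0r.
rewrite AFbr_er linear_sum (bigD1 y) //= linearZ /= AFcoord_e // eqxx [_ *: _]mulr1.
rewrite big1 ?addr0 1?mulrC // => w /negPf neq_wy; rewrite linearZ /=.
have [->|nzwz] := eqVneq (w + z) 0; first by rewrite AFe0 linear0 scaler0.
by rewrite AFcoord_e // (inj_eq (addIr z)) neq_wy scaler0.
Qed.

Lemma AFcoord_br_el x (y z : F) :
  AFcoord (z + y) (br (AFe z) x) = f z y * AFcoord y x.
Proof.
by rewrite AFbrC linearN /= (addrC z) AFcoord_br_er (AFcoefC _ _ _ y z) mulNr.
Qed.

(** Comparing coefficients of [e_(x+y+t)] in the Leibniz rule isolates the component of degree [t],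
    without assuming [D] homogeneous. *)
Lemma der_coef D t : D \in der br ->
  derivation_coef p a b t (fun x => AFcoord (x + t) (D (AFe x))).
Proof.
move=> /derP derD x y.
have <- : AFcoord (x + y + t) (D (br (AFe x) (AFe y))) =
          f x y * AFcoord (x + y + t) (D (AFe (x + y))).
  by rewrite AFbr_eE linearZ linearZ.
rewrite derD linearD /= -[in X in _ + X = _](addrA x) (addrAC x).
by rewrite AFcoord_br_er AFcoord_br_el.
Qed.

Lemma ad_sum_e (l : F -> F) (x : F) :
  ad br (\sum_t l t *: AFe t) (AFe x) = \sum_t (l t * f t x) *: AFe (x + t).
Proof.
rewrite lfunE /= (linear_sumlz (br : {bilinear _ -> _ -> _})).
apply: eq_bigr => t _; rewrite (linearZl_LR (br : {bilinear _ -> _ -> _})) /=.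
by rewrite AFbr_eE scalerA addrC.
Qed.

(* An inner derivation has no component of degree zero, as [e_0 = 0]. *)
Lemma AFcoord_inner D (x : F) : D \in inner_der br -> AFcoord x (D (AFe x)) = 0.
Proof.
move=> /inner_derP[y ->]; rewrite lfunE /= -{1}[x]add0r AFcoord_br_er.
by rewrite AFcoord0 mulr0.
Qed.

Lemma AFD_der (c : F -> F) : {morph c : x y / x + y} -> AFD c \in der br.
Proof.
move=> cD; rewrite memv_ker lfunE; apply/eqP/AF_lfunP => x nzx.
apply: AF_lfunP => y nzy; rewrite !lfunE /= /leibniz_defect !AFD_e.
rewrite (linearZl_LR (br : {bilinear _ -> _ -> _})).
rewrite (linearZr_LR (br : {bilinear _ -> _ -> _})) /= AFbr_eE linearZ /= AFD_e.
by rewrite !scalerA -scalerDl -scalerBl -mulrDl cD mulrC subrr scale0r.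
Qed.

Hypotheses (lt_ab : (a < b)%N) (lt_bn : (b < n)%N).

Lemma der_coef0_additive D : D \in der br ->
  {morph (fun x => AFcoord x (D (AFe x))) : x y / x + y}.
Proof.
move=> derD x y.
have c0 : AFcoord (0 + 0) (D (AFe 0)) = 0 by rewrite addr0 AFcoord0.
have := derivation_coef0_additive p_pr cardF lt_ab lt_bn c0 (der_coef 0 derD).
by move=> /(_ x y); rewrite !addr0.
Qed.

Lemma der_coef_inner D : D \in der br -> exists l : F -> F,
  forall t x, t != 0 -> AFcoord (x + t) (D (AFe x)) = l t * f t x.
Proof.
move=> derD; apply: (fin_all_exists (P := fun t lt => forall x, t != 0 -> 
  AFcoord (x + t) (D (AFe x)) = lt * f t x)) => t.
have [->|nzt] := eqVneq t 0; first by exists 0.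
have cN : AFcoord (- t + t) (D (AFe (- t))) = 0 by rewrite addNr AFcoord0.
have [l def_l] :=
  derivation_coef_inner p_pr cardF lt_ab lt_bn nzt cN (der_coef t derD).
by exists l.
Qed.

Lemma der_decomp D : D \in der br ->
  D - AFD (fun x => AFcoord x (D (AFe x))) \in inner_der br.
Proof.
move=> derD; have [l def_l] := der_coef_inner derD.
(* One element collects the inner components of all nonzero degrees; the coefficient at [t = 0] is a
   default. *)
apply/inner_derP; exists (\sum_(t : F) (if t == 0 then 0 else l t) *: AFe t).
apply: AF_lfunP => x nzx; rewrite ad_sum_e add_lfunE opp_lfunE AFD_e.
(* Indexing by the shift [t] turns each summand into a component of degree [t]; the one at [t = 0]
   cancels against [AFD]. *)
rewrite {1}(AF_sum_coord (D (AFe x))) (reindex_inj (addrI x)) /=.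
rewrite (bigD1 0) //= addr0 [RHS](bigD1 0) //= eqxx mul0r scale0r add0r.
rewrite [LHS]addrC addKr.
by apply: eq_bigr => t nzt; rewrite (negPf nzt) def_l.
Qed.

End AlbertFrankDerivations.

(** * The basis of outer derivations *)

Lemma lfun_exp_AFD (F : finFieldType) k :
  lfun_exp (AFD (@id F)) k = AFD (fun x : F => x ^+ k).
Proof.
apply: AF_lfunP => x _; rewrite AFD_e /lfun_exp.
elim: k => [|k IHk] /=; first by rewrite id_lfunE expr0 scale1r.
by rewrite comp_lfunE IHk linearZ /= AFD_e scalerA exprSr.
Qed.

Lemma out_class_eq0 (K : fieldType) (V : vectType K)
    (br : {bilinear V -> V -> V}) D :
  (out_class br D == 0) = (D \in inner_der br).
Proof. by rewrite /out_class -(linear0 (vpi (inner_der br))) vpi_eq subr0. Qed.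

Theorem theorem6p2 (p n a b : nat) (F : finFieldType)
    (p_pr : prime p) (lt_ab : (a < b)%N) (lt_bn : (b < n)%N)
    (cardF : #|F| = (p ^ n)%N) :
  [/\ \dim (outder (AFbr F a b p)) = n,
      forall D : 'End(AF F),
        D \in der (AFbr F a b p) -> AFdegree 0 D ->
        exists pi : {additive F -> F},
          D = AFD pi /\
          (forall xi : F, xi != 0 -> AFD pi (AFe xi) = pi xi *: AFe xi),
      forall (tau : F) (D : 'End(AF F)),
        tau != 0 -> D \in der (AFbr F a b p) -> AFdegree tau D ->
        D \in inner_der (AFbr F a b p),
      forall s : nat, (s < n)%N ->
        lfun_exp (AFD (@id F)) (p ^ s) \in der (AFbr F a b p) /\
        (forall xi : F, xi != 0 ->
           lfun_exp (AFD (@id F)) (p ^ s) (AFe xi) = xi ^+ (p ^ s) *: AFe xi)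
    & basis_of (outder (AFbr F a b p))
        [tuple out_class (AFbr F a b p) (lfun_exp (AFD (@id F)) (p ^ s)) | s < n]].
Proof.
set br := AFbr F a b p; set X := [tuple _ | s < n].
pose Ds (s : nat) : 'End(AF F) := lfun_exp (AFD (@id F)) (p ^ s).
have der_Ds s : Ds s \in der br.
  rewrite /Ds lfun_exp_AFD; apply: (AFD_der a b p_pr).
  exact: frobD cardF s.
have nth_X (s : 'I_n) : X`_s = out_class br (Ds s).
  by rewrite -tnth_nth tnth_mktuple.
have sum_X (k : 'I_n -> F) :
    \sum_s k s *: X`_s = out_class br (\sum_s k s *: Ds s).
  rewrite /out_class linear_sum; apply: eq_bigr => s _.
  by rewrite nth_X linearZ.
have sum_Ds (k : 'I_n -> F) x :
    (\sum_s k s *: Ds s) (AFe x) = (\sum_s k s * x ^+ (p ^ s)) *: AFe x.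
  rewrite sum_lfunE scaler_suml; apply: eq_bigr => s _.
  by rewrite scale_lfunE /Ds lfun_exp_AFD AFD_e scalerA.
have free_X : free X.
  (* A combination that is inner has zero diagonal coefficients, so [frob_free] applies to them. *)
  apply/freeP => k /eqP; rewrite sum_X out_class_eq0 => inner_k.
  apply: (frob_free p_pr cardF) => x; have [->|nzx] := eqVneq x 0.
    by apply: big1 => s _; rewrite (frob0 _ p_pr) mulr0.
  rewrite -[RHS](AFcoord_inner p_pr cardF x inner_k) sum_Ds linearZ /=.
  by rewrite AFcoord_e // eqxx [RHS]mulr1.
have basis_X : basis_of (outder br) X.
  rewrite /basis_of free_X andbT; apply/eqP/subv_anti/andP; split.
    apply/span_subvP => _ /tnthP[s ->]; rewrite tnth_mktuple /out_class.
    by rewrite -(lfunE (vpi (inner_der br))) memv_img ?der_Ds.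
  apply/subvP => _ /memv_imgP[D derD ->]; rewrite lfunE /=.
  (* Modulo inner derivations only the additive diagonal part of [D] remains, and it expands in
     Frobenius powers. *)
  have cD := der_coef0_additive p_pr cardF lt_ab lt_bn derD.
  have [k def_c] := additive_frobE p_pr cardF cD.
  suff -> : vpi (inner_der br) D = \sum_s k s *: X`_s.
    by apply: rpred_sum => s _; rewrite memvZ // memv_span // mem_nth ?size_tuple.
  rewrite sum_X; apply/eqP; rewrite vpi_eq.
  have -> : \sum_s k s *: Ds s = AFD (fun x => AFcoord x (D (AFe x))).
    by apply: AF_lfunP => x _; rewrite sum_Ds AFD_e def_c.
  exact: der_decomp cardF lt_ab lt_bn _ derD.
split=> //.
- by rewrite -(size_basis basis_X).
- move=> D derD deg0.
  have cD := der_coef0_additive p_pr cardF lt_ab lt_bn derD.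
  have c0 : AFcoord 0 (D (AFe 0)) = 0 by rewrite AFcoord0.
  pose pi : {additive F -> F} := HB.pack (fun x : F => AFcoord x (D (AFe x)))
    (GRing.isNmodMorphism.Build F F _ (conj c0 cD)).
  exists pi; split=> [|x _]; last exact: AFD_e.
  apply: AF_lfunP => x nzx; rewrite AFD_e /=.
  have := deg0 x nzx; rewrite addr0 => /vlineP[k ->].
  by rewrite linearZ /= AFcoord_e // eqxx [_ *: 1]mulr1.
- move=> t D nzt derD deg_t; have := der_decomp p_pr cardF lt_ab lt_bn derD.
  (* A map of nonzero degree has no diagonal part, so the decomposition leaves [D] itself. *)
  suff -> : AFD (fun x => AFcoord x (D (AFe x))) = 0 by rewrite subr0.
  apply: AF_lfunP => x nzx; rewrite AFD_e zero_lfunE.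
  have /vlineP[k ->] := deg_t x nzx; rewrite linearZ /=.
  have [->|nzxt] := eqVneq (x + t) 0; first by rewrite AFe0 linear0 !scaler0 scale0r.
  rewrite AFcoord_e // -[X in _ == X]addr0 (inj_eq (addrI x)) (negPf nzt).
  by rewrite scaler0 scale0r.
- move=> s _; split=> [|x _]; first exact: der_Ds.
  by rewrite lfun_exp_AFD AFD_e.
Qed.
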